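(* Let $\hat m,\hat n\in S^2$ with $\hat m^{\mathrm T}\hat n\in[0,1)$, let $\alpha,\gamma\in\mathbb R$ and $\beta\in[0,\pi]$, and put $\delta=\arccos\hat m^{\mathrm T}\hat n\in(0,\pi/2]$ and $\hat l=\|\hat m\times\hat n\|^{-1}\,\hat m\times\hat n$. Then for any $k\in\mathbb N$ and any $\beta_1,\dots,\beta_k\in(0,2\delta]$ satisfying $\beta=\beta_1+\cdots+\beta_k$, there exist $\alpha_j,\gamma_j,\theta_j\in\mathbb R$ such that $$R_{\hat l}(\beta_j)=R_{\hat m}(-\alpha_j)R_{\hat n}(\theta_j)R_{\hat m}(-\gamma_j)\qquad (j=1,\dots,k).$$ For these parameters it holds that $$R_{\hat m}(\alpha)R_{\hat l}(\beta)R_{\hat m}(\gamma)=R_{\hat m}(\alpha-\alpha_1)R_{\hat n}(\theta_1)\,R_{\hat m}(-\gamma_1-\alpha_2)R_{\hat n}(\theta_2)\,R_{\hat m}(-\gamma_2-\alpha_3)R_{\hat n}(\theta_3)\cdots R_{\hat m}(-\gamma_{k-1}-\alpha_k)R_{\hat n}(\theta_k)\,R_{\hat m}(-\gamma_k+\gamma).$$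
   Context: $\mathbb N$ is the set of strictly positive integers; $S^2=\{\hat v\in\mathbb R^3:\|\hat v\|=1\}$; $\arccos$ takes values in $[0,\pi]$. $I$ is the $2\times2$ identity matrix and $X=\begin{pmatrix}0&1\\1&0\end{pmatrix}$, $Y=\begin{pmatrix}0&-i\\i&0\end{pmatrix}$, $Z=\begin{pmatrix}1&0\\0&-1\end{pmatrix}$. For $\hat v=(v_x,v_y,v_z)^{\mathrm T}\in S^2$ and $\theta\in\mathbb R$, $$R_{\hat v}(\theta)=(\cos\tfrac\theta2)I-i(\sin\tfrac\theta2)(v_xX+v_yY+v_zZ)\in \mathrm{SU}(2).$$ *)

(* Defs.v *)
From HB Require Import structures.
From mathcomp Require Import all_boot all_order all_algebra.
From mathcomp Require Import complex.
From mathcomp Require Import reals trigo.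
Set Implicit Arguments.
Unset Strict Implicit.
Unset Printing Implicit Defensive.
Import Order.TTheory GRing.Theory Num.Theory.
Local Open Scope ring_scope.
Local Open Scope complex_scope.

Definition vec3 (R : realType) (a b c : R) : 'cV[R]_3 :=
  \col_(i < 3) nth 0 [:: a; b; c] i.

Definition vx (R : realType) (v : 'cV[R]_3) : R := v 0 0.
Definition vy (R : realType) (v : 'cV[R]_3) : R := v 1 0.
Definition vz (R : realType) (v : 'cV[R]_3) : R := v 2%:R 0.

Definition dot (R : realType) (u v : 'cV[R]_3) : R := (u^T *m v) 0 0.

(* The norm that MathComp-Analysis puts on matrices is the sup norm, so the
   Euclidean one is defined here. *)
Definition enorm (R : realType) (v : 'cV[R]_3) : R :=
  Num.sqrt (vx v ^+ 2 + vy v ^+ 2 + vz v ^+ 2).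

Definition cross (R : realType) (u v : 'cV[R]_3) : 'cV[R]_3 :=
  vec3 (vy u * vz v - vz u * vy v)
       (vz u * vx v - vx u * vz v)
       (vx u * vy v - vy u * vx v).

Definition on_S2 (R : realType) (v : 'cV[R]_3) : Prop := enorm v = 1.

Definition mx2 (K : nzRingType) (a b c d : K) : 'M[K]_2 :=
  \matrix_(i < 2, j < 2) nth 0 (nth [::] [:: [:: a; b]; [:: c; d]] i) j.

Definition PauliX (R : realType) : 'M[R[i]]_2 := mx2 0 1 1 0.
Definition PauliY (R : realType) : 'M[R[i]]_2 := mx2 0 (- 'i) 'i 0.
Definition PauliZ (R : realType) : 'M[R[i]]_2 := mx2 1 0 0 (- 1).

(* Defined for every v, although it lies in SU(2) only for unit v. *)
Definition Rot (R : realType) (v : 'cV[R]_3) (theta : R) : 'M[R[i]]_2 :=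
  (cos (theta / 2))%:C *: 1%:M
  - ('i * (sin (theta / 2))%:C) *:
      ((vx v)%:C *: PauliX R + (vy v)%:C *: PauliY R + (vz v)%:C *: PauliZ R).

(* Main.v *)
(* With l the normalized cross product, (m, l x m, l) is a right-handed
   orthonormal frame in which n = cos delta m + sin delta (l x m).  Computing
   R_m(a) R_l(b) R_m(g) as a quaternion, the choice (a - g) / 2 = - pi / 2 kills
   its l-component, and it equals R_n(2 t) exactly when sin (b/2) = sin t sin delta
   and, for p = (a + g) / 2, cos (b/2) sin p = sin t cos delta and
   cos (b/2) cos p = cos t.  The first equation is solvable in t because
   b/2 <= delta <= pi/2; then p exists because the squares of the two remaining
   right-hand sides add up to cos (b/2) ^ 2.  The product formula is additivity
   of R_m and R_l, by telescoping. *)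
Require Import Defs.
From HB Require Import structures.
From mathcomp Require Import all_boot all_order all_algebra.
From mathcomp Require Import complex.
From mathcomp Require Import reals trigo.
From mathcomp Require Import boolp ring lra.
Import Order.TTheory GRing.Theory Num.Theory.
Local Open Scope ring_scope.

(** * Coordinates, dot and cross products *)

Lemma mx2E (K : nzRingType) (A : 'M[K]_2) : A = mx2 (A 0 0) (A 0 1) (A 1 0) (A 1 1).
Proof.
apply/matrixP => -[[|[|//]] ?] [[|[|//]] ?]; rewrite !mxE /=;
  by congr (A _ _); apply: val_inj.
Qed.

Lemma cV3P {R : realType} (u v : 'cV[R]_3) :
  vx u = vx v -> vy u = vy v -> vz u = vz v -> u = v.
Proof.
move=> ux uy uz; apply/matrixP => i j; rewrite (ord1 j).
case: i => -[|[|[|//]]] i3.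
- by rewrite (_ : Ordinal i3 = 0) //; apply: val_inj.
- by rewrite (_ : Ordinal i3 = 1) //; apply: val_inj.
- by rewrite (_ : Ordinal i3 = 2%:R) //; apply: val_inj.
Qed.

Lemma dotE {R : realType} (u v : 'cV[R]_3) :
  dot u v = vx u * vx v + vy u * vy v + vz u * vz v.
Proof.
rewrite /dot !mxE !big_ord_recl big_ord0 addr0 !mxE addrA.
by congr (_ * _ + _ * _ + _ * _); congr fun_of_matrix; apply: val_inj.
Qed.

Lemma vxD {R : realType} (u v : 'cV[R]_3) : vx (u + v) = vx u + vx v.
Proof. by rewrite /vx mxE. Qed.
Lemma vyD {R : realType} (u v : 'cV[R]_3) : vy (u + v) = vy u + vy v.
Proof. by rewrite /vy mxE. Qed.
Lemma vzD {R : realType} (u v : 'cV[R]_3) : vz (u + v) = vz u + vz v.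
Proof. by rewrite /vz mxE. Qed.
Lemma vxZ {R : realType} a (v : 'cV[R]_3) : vx (a *: v) = a * vx v.
Proof. by rewrite /vx mxE. Qed.
Lemma vyZ {R : realType} a (v : 'cV[R]_3) : vy (a *: v) = a * vy v.
Proof. by rewrite /vy mxE. Qed.
Lemma vzZ {R : realType} a (v : 'cV[R]_3) : vz (a *: v) = a * vz v.
Proof. by rewrite /vz mxE. Qed.
Lemma vx_cross {R : realType} (u v : 'cV[R]_3) :
  vx (cross u v) = vy u * vz v - vz u * vy v.
Proof. by rewrite /vx mxE. Qed.
Lemma vy_cross {R : realType} (u v : 'cV[R]_3) :
  vy (cross u v) = vz u * vx v - vx u * vz v.
Proof. by rewrite /vy mxE. Qed.
Lemma vz_cross {R : realType} (u v : 'cV[R]_3) :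
  vz (cross u v) = vx u * vy v - vy u * vx v.
Proof. by rewrite /vz mxE. Qed.
Definition coordE := (@vxD, @vyD, @vzD, @vxZ, @vyZ, @vzZ,
  @vx_cross, @vy_cross, @vz_cross).

Lemma dotDl {R : realType} (u v w : 'cV[R]_3) : dot (u + v) w = dot u w + dot v w.
Proof. by rewrite !dotE !coordE; ring. Qed.
Lemma dotZl {R : realType} a (u v : 'cV[R]_3) : dot (a *: u) v = a * dot u v.
Proof. by rewrite !dotE !coordE; ring. Qed.
Lemma dotC {R : realType} (u v : 'cV[R]_3) : dot u v = dot v u.
Proof. by rewrite !dotE; ring. Qed.
Lemma dot_crossl {R : realType} (u v : 'cV[R]_3) : dot u (cross u v) = 0.
Proof. by rewrite dotE !coordE; ring. Qed.
Lemma crossDl {R : realType} (u v w : 'cV[R]_3) :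
  cross (u + v) w = cross u w + cross v w.
Proof. by apply: cV3P; rewrite !coordE; ring. Qed.
Lemma crossZl {R : realType} a (u v : 'cV[R]_3) : cross (a *: u) v = a *: cross u v.
Proof. by apply: cV3P; rewrite !coordE; ring. Qed.
Lemma crossZr {R : realType} a (u v : 'cV[R]_3) : cross u (a *: v) = a *: cross u v.
Proof. by apply: cV3P; rewrite !coordE; ring. Qed.
Lemma crossxx {R : realType} (u : 'cV[R]_3) : cross u u = 0.
Proof. by apply: cV3P; rewrite !coordE; rewrite /vx /vy /vz mxE; ring. Qed.
(** Vector triple product; the minus sign sits in a scalar because [coordE] covers only sums and
    scalings. *)
Lemma cross_cross {R : realType} (u v w : 'cV[R]_3) :
  cross (cross u v) w = dot u w *: v + (- dot v w) *: u.
Proof. by apply: cV3P; rewrite !dotE !coordE; ring. Qed.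
(** Lagrange's identity: for unit vectors at angle delta, the cross product has length sin delta. *)
Lemma dot_cross_cross {R : realType} (u v : 'cV[R]_3) :
  dot (cross u v) (cross u v) = dot u u * dot v v - dot u v ^+ 2.
Proof. by rewrite !dotE !coordE; ring. Qed.

Lemma enormE {R : realType} (v : 'cV[R]_3) : enorm v = Num.sqrt (dot v v).
Proof. by rewrite /enorm dotE -!expr2. Qed.

Lemma on_S2_dot {R : realType} (v : 'cV[R]_3) : on_S2 v -> dot v v = 1.
Proof.
rewrite /on_S2 enormE => /(congr1 (fun x => x ^+ 2)).
by rewrite sqr_sqrtr ?expr1n // dotE -!expr2 !addr_ge0 ?sqr_ge0.
Qed.

(** * Rotations as quaternions *)

Local Open Scope complex_scope.

(* The matrix w I - i (v . sigma), i.e. the quaternion with scalar part w and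
   vector part v. *)
Definition quat {R : realType} (w : R) (v : 'cV[R]_3) : 'M[R[i]]_2 :=
  mx2 (w -i* vz v) (- vy v -i* vx v) (vy v -i* vx v) (w +i* vz v).

Lemma RotE {R : realType} (v : 'cV[R]_3) t :
  Rot v t = quat (cos (t / 2)) (sin (t / 2) *: v).
Proof.
rewrite /quat !coordE [LHS]mx2E; congr mx2; rewrite !mxE /=; simpc; congr Complex; ring.
Qed.

Lemma quatM {R : realType} (w w' : R) (v v' : 'cV[R]_3) :
  quat w v *m quat w' v' =
  quat (w * w' - dot v v') (w *: v' + w' *: v + cross v v').
Proof.
rewrite /quat dotE !coordE [LHS]mx2E.
congr mx2; rewrite !mxE !big_ord_recl big_ord0 !mxE /=; simpc; congr Complex; ring.
Qed.

Lemma quat1 {R : realType} : quat (1 : R) 0 = 1%:M.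
Proof.
rewrite /quat [RHS]mx2E !mxE /vx /vy /vz !mxE /=.
by congr mx2; congr Complex; rewrite ?oppr0.
Qed.

Lemma Rot0 {R : realType} (v : 'cV[R]_3) : Rot v 0 = 1%:M.
Proof. by rewrite RotE mul0r cos0 sin0 scale0r quat1. Qed.

Lemma RotD {R : realType} (v : 'cV[R]_3) s t :
  dot v v = 1 -> Rot v (s + t) = Rot v s *m Rot v t.
Proof.
move=> v1; rewrite !RotE quatM mulrDl cosD sinD dotZl dotC dotZl v1.
rewrite crossZl crossZr crossxx !scaler0 addr0.
by congr quat; [ring | apply: cV3P; rewrite !coordE; ring].
Qed.

(** The scalar part of [Rot l b] commutes with the outer rotations, which merge into the angle
    [a + g]. Its vector part is orthogonal to [m], so it anticommutes with [m]; moving it past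
    [Rot m g] flips [g], whence [a - g]. *)
Lemma Rot_euler {R : realType} (m l : 'cV[R]_3) a b g :
  dot m m = 1 -> dot l m = 0 ->
  Rot m a *m Rot l b *m Rot m g =
  quat (cos (b / 2) * cos ((a + g) / 2))
    ((cos (b / 2) * sin ((a + g) / 2)) *: m +
     (sin (b / 2) * cos ((a - g) / 2)) *: l +
     (- sin (b / 2) * sin ((a - g) / 2)) *: cross l m).
Proof.
move=> m1 lm; rewrite !RotE !quatM.
rewrite !(crossDl, crossZl, crossZr) crossxx cross_cross m1 lm.
rewrite !dotDl !dotZl ![dot m (_ *: _)]dotC ![dot l (_ *: _)]dotC.
rewrite ![dot (cross _ _) (_ *: _)]dotC !dotZl dot_crossl m1 lm (dotC m l) lm.
rewrite !mulrDl !mulNr cosD cosB sinD sinB.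
congr quat; first by ring.
by apply: cV3P; rewrite !coordE /vx /vy /vz !mxE /=; ring.
Qed.

(** * Trigonometry of the right spherical triangle *)

Lemma angle_exists {R : realType} (x y : R) : x ^+ 2 + y ^+ 2 = 1 -> 0 <= y ->
  exists t, cos t = x /\ sin t = y.
Proof.
move=> xy1 y0; have x1 : -1 <= x <= 1.
  by apply/andP; split; nra.
(* The sine is nonnegative on [0, pi], so it is the square root [y] and not [- y]. *)
exists (acos x); rewrite acosK ?in_itv //; split=> //.
by rewrite sin_acos // -xy1 addrAC subrr add0r sqrtr_sqr ger0_norm.
Qed.

Lemma acos_le_pihalf {R : realType} (c : R) : 0 <= c <= 1 -> acos c <= pi / 2.
Proof.
move=> /andP[c0 c1]; have c11 : -1 <= c <= 1 by lra.
rewrite leNgt; apply/negP.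
have pi0 := @pi_gt0 R.
rewrite -ltr_cos ?in_itv /= ?acos_ge0 ?acos_lepi //; last lra.
by rewrite acosK ?in_itv // cos_pihalf ltNge c0.
Qed.

(** These are the relations in a right spherical triangle with legs [b] and [p], hypotenuse [t], and
    angle [acos c] opposite [b]. Here [b] and [t] stand for half rotation angles. *)
Lemma spherical_triangle {R : realType} (c b : R) :
  0 <= c < 1 -> 0 <= b <= acos c ->
  exists p t, [/\ cos b * cos p = cos t, cos b * sin p = sin t * c &
                  sin b = sin t * Num.sqrt (1 - c ^+ 2)].
Proof.
move=> /andP[c0 c1] /andP[b0 bc]; have c11 : -1 <= c <= 1 by lra.
have pi0 := @pi_gt0 R.
have bpi : b <= pi by rewrite (le_trans bc) ?acos_lepi.
have c_le : c <= cos b.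
  rewrite -[c]acosK ?in_itv // leNgt; apply/negP.
  by rewrite ltr_cos ?in_itv /= ?acos_ge0 ?acos_lepi ?b0 // ltNge bc.
have s2 : Num.sqrt (1 - c ^+ 2) ^+ 2 = 1 - c ^+ 2 by rewrite sqr_sqrtr //; nra.
have s0 : 0 < Num.sqrt (1 - c ^+ 2) by rewrite sqrtr_gt0; nra.
move: s2 s0; set s := Num.sqrt _ => s2 s0.
have sb0 : 0 <= sin b by rewrite sin_ge0_pi // b0.
have y0 : 0 <= sin b / s by rewrite divr_ge0 // ltW.
have yE : (sin b / s) * s = sin b by rewrite divfK // gt_eqF.
move: (cos2Dsin2 b) => cs1.
(* From 0 <= c <= cos b follows sin^2 b <= 1 - c^2 = s^2, so the quotient is a sine. *)
have y1 : (sin b / s) ^+ 2 <= 1.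
  by rewrite expr_div_n s2 ler_pdivrMr; nra.
move: (sin b / s) y0 yE y1 => y y0 yE y1.
have [t [ct st]] : exists t, cos t = Num.sqrt (1 - y ^+ 2) /\ sin t = y.
  by apply: angle_exists => //; rewrite sqr_sqrtr ?subr_ge0 ?subrK.
have key : cos t ^+ 2 + (sin t * c) ^+ 2 = cos b ^+ 2.
  rewrite cos2sin2 st exprMn.
  have -> : c ^+ 2 = 1 - s ^+ 2 by rewrite s2; ring.
  have -> : cos b ^+ 2 = 1 - sin b ^+ 2 by rewrite cos2sin2.
  by rewrite -yE; ring.
(* If cos b = 0, [key] forces both remaining right-hand sides to vanish, so any [p] would do. *)
have [cb0|cb0] := eqVneq (cos b) 0.
  exists 0, t; rewrite st yE !cb0 !mul0r; split=> //.
    by apply/eqP; rewrite eq_sym -sqrf_eq0; apply/eqP; move: key; rewrite cb0; nra.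
  by apply/eqP; rewrite eq_sym -sqrf_eq0 -st; apply/eqP; move: key; rewrite cb0; nra.
have [p [cp sp]] : exists p, cos p = cos t / cos b /\ sin p = sin t * c / cos b.
  apply: angle_exists.
    by rewrite !expr_div_n -mulrDl key divff // expf_neq0.
  by rewrite st !mulr_ge0 // invr_ge0 (le_trans c0).
by exists p, t; rewrite cp sp ![cos b * _]mulrC !divfK // st yE.
Qed.

(** * Decomposition of a single rotation about [l] *)

Lemma RotNK {R : realType} (v : 'cV[R]_3) t :
  dot v v = 1 -> Rot v (- t) *m Rot v t = 1%:M.
Proof. by move=> v1; rewrite -RotD // addNr Rot0. Qed.

Lemma RotKN {R : realType} (v : 'cV[R]_3) t :
  dot v v = 1 -> Rot v t *m Rot v (- t) = 1%:M.
Proof. by move=> v1; rewrite -RotD // subrr Rot0. Qed.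

Lemma mulmx_sandwichK {K : comNzRingType} {d : nat} (A A' B B' L : 'M[K]_d) :
  A' *m A = 1%:M -> B *m B' = 1%:M -> A' *m (A *m L *m B) *m B' = L.
Proof.
by move=> AK BK; rewrite !mulmxA AK mul1mx -mulmxA BK mulmx1.
Qed.

Lemma Rot_decomp {R : realType} (m n : 'cV[R]_3) b :
  dot m m = 1 -> dot n n = 1 -> 0 <= dot m n < 1 ->
  0 <= b <= 2 * acos (dot m n) ->
  exists a g t, Rot ((enorm (cross m n))^-1 *: cross m n) b =
    Rot m (- a) *m Rot n t *m Rot m (- g).
Proof.
move=> m1 n1 c01 b01; set l := _ *: _.
have [p [t [cp sp sb]]] : exists p t, [/\ cos (b / 2) * cos p = cos t,
    cos (b / 2) * sin p = sin t * dot m n &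
    sin (b / 2) = sin t * enorm (cross m n)].
  rewrite enormE dot_cross_cross m1 n1 mul1r.
  by apply: spherical_triangle => //; lra.
have s0 : enorm (cross m n) != 0.
  rewrite enormE dot_cross_cross m1 n1 mul1r sqrtr_eq0 -ltNge; nra.
have lm : dot l m = 0 by rewrite dotZl dotC dot_crossl mulr0.
(* Half the sum of the first two angles is [p] and half their difference is - pi / 2; [t] is a half
   angle, hence the doubling. *)
exists (p - pi / 2), (p + pi / 2), (t * 2).
have -> : Rot n (t * 2) =
    Rot m (p - pi / 2) *m Rot l b *m Rot m (p + pi / 2).
  rewrite Rot_euler // RotE mulfK ?pnatr_eq0 //.
  have -> : (p - pi / 2 + (p + pi / 2)) / 2 = p by field.
  have -> : (p - pi / 2 - (p + pi / 2)) / 2 = - (pi / 2) by field.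
  (* Up to the factor ||m x n||^-1, [cross l m] is n - (m . n) m. Its [m] term cancels the one
     already present and leaves sin t n. *)
  rewrite cosN sinN cos_pihalf sin_pihalf cp sp sb crossZl cross_cross.
  congr quat; rewrite m1 (dotC n m) mulr0 scale0r addr0 mulrN1 opprK scale1r.
  by rewrite scalerA mulfK // scalerDr scalerA mulrN scaleNr addrCA subrr addr0.
by symmetry; apply: mulmx_sandwichK; [exact: RotNK | exact: RotKN].
Qed.

(** * Telescoping and the product formula *)

Lemma prod_conj_telescope {V W : zmodType} {K : nzRingType} {d : nat}
    (F : V -> 'M[K]_d.+1) (G : W -> 'M[K]_d.+1) (N : nat -> 'M[K]_d.+1) (x y : V)
    (b : nat -> W) (a g : nat -> V) (k : nat) :
  (0 < k)%N ->
  (forall s t, F (s + t) = F s *m F t) -> (forall s t, G (s + t) = G s *m G t) ->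
  (forall j : nat, (1 <= j <= k)%N ->
     G (b j) = F (- a j) *m N j *m F (- g j)) ->
  F x *m G (\sum_(1 <= j < k.+1) b j) *m F y =
  F (x - a 1%N) *m N 1%N
  *m (\prod_(2 <= j < k.+1) (F (- g j.-1 - a j) *m N j))
  *m F (- g k + y).
Proof.
(* The induction starts at one factor. It keeps [y] general: splitting off the last factor leaves
   the shorter product with [- a] of the last index in place of [y]. *)
move=> k0 FD GD; case: k k0 => // k _; elim: k y => [|k IHk] y Gb.
  by rewrite big_nat1 Gb // big_geq // mulmx1 !FD !mulmxA.
rewrite big_nat_recr //= GD mulmxA Gb ?leqnn // -!mulmxA -!FD !mulmxA.
rewrite IHk => [|j /andP[j1 jk]]; last by apply: Gb; rewrite j1 leqW.
by rewrite [in RHS]big_nat_recr //= -!mulmxE !mulmxA.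
Qed.

Local Close Scope complex_scope.

Theorem proposition1 (R : realType) (m n : 'cV[R]_3)
    (hm : on_S2 m) (hn : on_S2 n) (hmn : 0 <= dot m n < 1)
    (alpha gamma beta : R) (hbeta : 0 <= beta <= pi) :
  let delta : R := acos (dot m n) in
  let l : 'cV[R]_3 := (enorm (cross m n))^-1 *: cross m n in
  0 < delta <= pi / 2 /\
  forall (k : nat) (hk : (0 < k)%N) (beta_ : nat -> R)
    (hbeta_ : forall j : nat, (1 <= j <= k)%N -> 0 < beta_ j <= 2 * delta)
    (hsum : beta = \sum_(1 <= j < k.+1) beta_ j),
  (exists alpha_ gamma_ theta_ : nat -> R,
     forall j : nat, (1 <= j <= k)%N ->
       Rot l (beta_ j) =
       Rot m (- alpha_ j) *m Rot n (theta_ j) *m Rot m (- gamma_ j))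
  /\
  (forall alpha_ gamma_ theta_ : nat -> R,
     (forall j : nat, (1 <= j <= k)%N ->
       Rot l (beta_ j) =
       Rot m (- alpha_ j) *m Rot n (theta_ j) *m Rot m (- gamma_ j)) ->
     Rot m alpha *m Rot l beta *m Rot m gamma =
     Rot m (alpha - alpha_ 1%N) *m Rot n (theta_ 1%N)
     *m (\prod_(2 <= j < k.+1)
           (Rot m (- gamma_ j.-1 - alpha_ j) *m Rot n (theta_ j)))
     *m Rot m (- gamma_ k + gamma)).
Proof.
move=> delta l; have m1 := on_S2_dot m hm; have n1 := on_S2_dot n hn.
have /andP[c0 c1] := hmn.
split; first by rewrite acos_gt0 ?acos_le_pihalf ?c0 ?c1 ?ltW //; lra.
move=> k k0 beta_ hbeta_ hsum; split.
  have /choice[f fP] : forall j : nat, exists agt : R * R * R, (1 <= j <= k)%N ->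
      Rot l (beta_ j) = Rot m (- agt.1.1) *m Rot n agt.2 *m Rot m (- agt.1.2).
    move=> j; have [/hbeta_/andP[b0 bd]|_] := boolP (1 <= j <= k)%N; last first.
      (* Outside 1..k nothing is required, so a default triple serves. *)
      by exists (0, 0, 0).
    have [|a [g [t E]]] := Rot_decomp m n (beta_ j) m1 n1 hmn.
      by rewrite (ltW b0).
    by exists (a, g, t).
  by exists (fun j => (f j).1.1), (fun j => (f j).1.2), (fun j => (f j).2).
(* Additivity of [Rot l] rests on [l] being a unit vector; [cross m n] is nonzero since 0 <= m . n <
   1. *)
have l1 : dot l l = 1.
  have d0 : 0 < dot (cross m n) (cross m n).
    by rewrite dot_cross_cross m1 n1; nra.
  rewrite dotZl dotC dotZl mulrA -expr2 exprVn enormE sqr_sqrtr ?ltW //.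
  by rewrite mulVf // gt_eqF.
move=> alpha_ gamma_ theta_ Rl; rewrite hsum.
apply: (prod_conj_telescope (Rot m) (Rot l) (fun j => Rot n (theta_ j))).
- exact: k0.
- by move=> s t; apply: RotD.
- by move=> s t; apply: RotD.
- exact: Rl.
Qed.
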